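(* For every set $X$, the semigroup $\mathcal{IP}_X$ is isomorphic to the dual symmetric inverse monoid $\mathcal{I}^{\ast}_X$.
   Context: Let $X$ be an arbitrary set and let $X'=\{x':x\in X\}$ be a disjoint copy of $X$, with $x\mapsto x'$ a fixed bijection $X\to X'$; the inverse bijection is also denoted by $'$. Let $\mathcal{CS}_X$ be the set of all partitions of $X\cup X'$ into nonempty blocks. For $a\in\mathcal{CS}_X$ write $x\equiv_a y$ if $x,y\in X\cup X'$ lie in the same block of $a$. The product $ab$ of $a,b\in\mathcal{CS}_X$ is the partition corresponding to the equivalence relation $\equiv$ on $X\cup X'$ defined, for $x,y\in X$, by: (i) $x\equiv y$ iff $x\equiv_a y$ or there are $s\ge 1$ and $c_1,\dots,c_{2s}\in X$ with $x\equiv_a c_1'$, $c_1\equiv_b c_2$, $c_2'\equiv_a c_3'$, $\dots$, $c_{2s-1}\equiv_b c_{2s}$, $c_{2s}'\equiv_a y$; (ii) $x'\equiv y'$ iff $x'\equiv_b y'$ or there are $s\ge 1$ and $c_1,\dots,c_{2s}\in X$ with $x'\equiv_b c_1$, $c_1'\equiv_a c_2'$, $c_2\equiv_b c_3$, $\dots$, $c_{2s-1}'\equiv_a c_{2s}'$, $c_{2s}\equiv_b y'$; (iii) $x\equiv y'$ iff $y'\equiv x$ iff there are $s\ge 1$ and $c_1,\dots,c_{2s-1}\in X$ with $x\equiv_a c_1'$, $c_1\equiv_b c_2$, $c_2'\equiv_a c_3'$, $\dots$, $c_{2s-2}'\equiv_a c_{2s-1}'$, $c_{2s-1}\equiv_b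 y'$. With this product $\mathcal{CS}_X$ is a semigroup, and $\mathcal{IP}_X$ is the subsemigroup of all $a\in\mathcal{CS}_X$ each of whose blocks meets both $X$ and $X'$. The dual symmetric inverse monoid $\mathcal{I}^{\ast}_X$ consists of all biequivalences on $X$, i.e. all binary relations $\alpha\subseteq X\times X$ that are full ($X\alpha=\alpha X=X$, i.e. the domain and the range of $\alpha$ are both $X$) and bifunctional ($\alpha\circ\alpha^{-1}\circ\alpha=\alpha$). Here $\circ$ is composition of relations from left to right: $(x,z)\in\alpha\circ\beta$ iff $(x,y)\in\alpha$ and $(y,z)\in\beta$ for some $y$. The multiplication in $\mathcal{I}^{\ast}_X$ is $\alpha\beta=\alpha\circ(\alpha^{-1}\circ\alpha\vee\beta\circ\beta^{-1})\circ\beta$, where $\vee$ is the join of equivalence relations (for a biequivalence $\alpha$ both $\alpha\circ\alpha^{-1}$ and $\alpha^{-1}\circ\alpha$ are equivalence relations). *)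

(* Defs.v *)
From Stdlib Require Import Relations.
From HB Require Import structures.
From mathcomp Require Import all_boot zify.
From mathcomp Require Import boolp classical_sets.

Set Implicit Arguments.
Unset Strict Implicit.
Unset Printing Implicit Defensive.

Local Open Scope classical_set_scope.

(* Partitions of X + X, where [inl x] stands for the element x of X and
   [inr x] for its copy x'. *)
Record CS (X : Type) := MkCS {
  blocks : set (set (X + X));
  blocksP : partition blocks id [set: X + X] }.

Definition same_block (X : Type) (a : CS X) (u v : X + X) : Prop :=
  exists2 B, blocks a B & B u /\ B v.

(* The relation defining the product of [a] and [b].  The finite sequence
   c_1, c_2, ... is encoded by a function on nat, of which only the values at
   1, ..., 2s (resp. 1, ..., 2s - 1) are relevant. *)
Definition mul_rel (X : Type) (a b : CS X) (u v : X + X) : Prop :=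
  match u, v with
  | inl x, inl y =>
      same_block a (inl x) (inl y) \/
      exists (s : nat) (c : nat -> X),
        [/\ 1 <= s,
            same_block a (inl x) (inr (c 1)),
            forall i, 1 <= i <= s ->
              same_block b (inl (c (2 * i - 1))) (inl (c (2 * i))),
            forall i, 1 <= i < s ->
              same_block a (inr (c (2 * i))) (inr (c (2 * i + 1)))
          & same_block a (inr (c (2 * s))) (inl y)]
  | inr x, inr y =>
      same_block b (inr x) (inr y) \/
      exists (s : nat) (c : nat -> X),
        [/\ 1 <= s,
            same_block b (inr x) (inl (c 1)),
            forall i, 1 <= i <= s ->
              same_block a (inr (c (2 * i - 1))) (inr (c (2 * i))),
            forall i, 1 <= i < s ->
              same_block b (inl (c (2 * i))) (inl (c (2 * i + 1)))
          & same_block b (inl (c (2 * s))) (inr y)]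
  | inl x, inr y | inr y, inl x =>
      exists (s : nat) (c : nat -> X),
        [/\ 1 <= s,
            same_block a (inl x) (inr (c 1)),
            forall i, 1 <= i < s ->
              same_block b (inl (c (2 * i - 1))) (inl (c (2 * i))),
            forall i, 1 <= i < s ->
              same_block a (inr (c (2 * i))) (inr (c (2 * i + 1)))
          & same_block b (inl (c (2 * s - 1))) (inr y)]
  end.

Section SameBlock.
Variable X : Type.
Implicit Types (a b : CS X) (u v w : X + X).

Lemma same_block_refl a u : same_block a u u.
Proof.
have [covT _ _] := blocksP a.
have : [set: X + X] u by [].
by rewrite -covT => -[B aB Bu]; exists B.
Qed.

Lemma same_block_sym a u v : same_block a u v -> same_block a v u.
Proof. by case=> B aB [Bu Bv]; exists B. Qed.

Lemma same_block_trans a u v w :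
  same_block a u v -> same_block a v w -> same_block a u w.
Proof.
case=> B aB [Bu Bv] [C aC [Cv Cw]]; exists B => //; split=> //.
have [_ triv _] := blocksP a.
by rewrite (triv B C aB aC) //; exists v.
Qed.

Lemma blockE a B u : blocks a B -> B u -> B = [set v | same_block a u v].
Proof.
move=> aB Bu; apply/seteqP; split=> v /=; first by exists B.
case=> C aC [Cu Cv]; have [_ triv _] := blocksP a.
by rewrite (triv B C aB aC) //; exists u.
Qed.

Lemma blocks_same_block a : blocks a = range (fun u => [set v | same_block a u v]).
Proof.
apply/seteqP; split=> [B aB|_ [u _ <-]].
  have [_ _ /(_ B aB) [u Bu]] := blocksP a.
  by exists u => //; rewrite -(blockE aB Bu).
have [B aB [Bu _]] := same_block_refl a u.
by rewrite -(blockE aB Bu).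
Qed.

Lemma CS_ext a b :
  (forall u v, same_block a u v <-> same_block b u v) -> a = b.
Proof.
move=> ab; have : blocks a = blocks b.
  rewrite !blocks_same_block; apply: (congr1 (fun f => range f)).
  apply/funext => u.
  by apply/seteqP; split=> v /= /ab.
case: a {ab} => A pA; case: b => B pB /= AB; rewrite AB in pA *.
by congr MkCS; exact: Prop_irrelevance.
Qed.

End SameBlock.

Section OfEquivalence.
Variables (X : Type) (E : X + X -> X + X -> Prop).
Hypothesis eqE : equivalence (X + X) E.

Lemma partition_of_equivalence :
  partition (range (fun u => [set v | E u v])) id [set: X + X].
Proof.
have [r t s] := eqE; split.
- by apply/seteqP; split=> // u _; exists [set v | E u v].
- move=> _ _ [u _ <-] [v _ <-] [w [/= uw vw]].
  apply/seteqP; split=> x /= h.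
    exact: t vw (t _ _ _ (s _ _ uw) h).
  exact: t uw (t _ _ _ (s _ _ vw) h).
- by move=> _ [u _ <-]; exists u; exact: r.
Qed.

Definition CS_of_equivalence : CS X := MkCS partition_of_equivalence.

Lemma same_block_of_equivalence u v :
  same_block CS_of_equivalence u v <-> E u v.
Proof.
have [r t s] := eqE; split=> [[_ [w _ <-] [/= wu wv]]|uv].
  exact: t (s _ _ wu) wv.
by exists [set v | E u v]; [exists u | split=> //=; exact: r].
Qed.

End OfEquivalence.

(* Any composite of two equivalence relations [A] and [B] can be written as an
   alternating one. *)
Lemma alternating (X : Type) (A B : X -> X -> Prop) (c d : X) :
  (forall x, A x x) -> (forall x, B x x) ->
  clos_refl_trans X (union X A B) c d ->
  exists (n : nat) (f : nat -> X), [/\ f 1 = c, f (2 * n + 1) = d,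
    forall i, 1 <= i <= n -> B (f (2 * i - 1)) (f (2 * i)) &
    forall i, 1 <= i <= n -> A (f (2 * i)) (f (2 * i + 1))].
Proof.
move=> rA rB /clos_rt_rtn1_iff; elim=> [|{}d e de _ [n [f [f1 fd fB fA]]]].
  by exists 0, (fun=> c); split=> // i; lia.
have [z [Bdz Aze]] : exists z, B d z /\ A z e.
  by case: de => h; [exists d | exists e].
exists n.+1, (fun m => if m <= 2 * n + 1 then f m
                       else if m == 2 * n + 2 then z else e); split.
- by rewrite ifT //; lia.
- by rewrite ifF ?ifF //; lia.
- move=> i i_n; have [in'|in'] : i <= n \/ i = n.+1 by lia.
    by rewrite !ifT; [apply: fB; lia | lia | lia].
  rewrite in'; have -> : 2 * n.+1 - 1 = 2 * n + 1 by lia.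
  by rewrite leqnn fd ifF ?ifT //; lia.
- move=> i i_n; have [in'|in'] : i <= n \/ i = n.+1 by lia.
    by rewrite !ifT; [apply: fA; lia | lia | lia].
  rewrite in'; have -> : 2 * n.+1 = 2 * n + 2 by lia.
  rewrite ifF; last by lia.
  by rewrite eqxx ifF; [rewrite ifF //; lia | lia].
Qed.

Section Glue.
Variable X : Type.
Implicit Types (a b c : CS X) (u v w : X + X) (p q r : nat * X).

(* The vertex set is a countable family of copies of X; [edge a i j] puts the
   partition [a] on the disjoint union of the copies with indices i and j. *)
Definition level (i j : nat) u : nat * X :=
  match u with inl x => (i, x) | inr x => (j, x) end.

Definition edge a i j p q : Prop :=
  exists u v, [/\ p = level i j u, q = level i j v & same_block a u v].

Definition glue a b i j k := clos_refl_trans (nat * X)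
  (union (nat * X) (edge a i j) (edge b j k)).

Lemma edge_sym a i j p q : edge a i j p q -> edge a i j q p.
Proof.
by move=> [u [v [-> -> uv]]]; exists v, u; split=> //; exact: same_block_sym.
Qed.

Lemma clos_rt_symmetric (T : Type) (R : relation T) :
  (forall x y, R x y -> R y x) ->
  forall x y, clos_refl_trans T R x y -> clos_refl_trans T R y x.
Proof.
move=> sR x y; elim=> [{}x {}y /sR|{}x|{}x {}y z _ yx _ zy].
- exact: rt_step.
- exact: rt_refl.
- exact: rt_trans zy yx.
Qed.

Lemma glue_sym a b i j k p q : glue a b i j k p q -> glue a b i j k q p.
Proof.
apply: clos_rt_symmetric => {p q} p q [] /edge_sym; first by left.
by right.
Qed.

Let mida a x y := same_block a (inr x) (inr y).

Let midb b x y := same_block b (inl x) (inl y).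

Let E a b := clos_refl_trans X (union X (mida a) (midb b)).

Let attach a b u x : Prop := match u with
  | inl y => same_block a (inl y) (inr x)
  | inr y => same_block b (inr y) (inl x) end.

Let short a b u v : Prop := match u, v with
  | inl x, inl y => same_block a (inl x) (inl y)
  | inr x, inr y => same_block b (inr x) (inr y)
  | _, _ => False end.

Let linked a b u v : Prop := short a b u v \/
  exists x y, [/\ attach a b u x, E a b x y & attach a b v y].

Let E_sym a b x y : E a b x y -> E a b y x.
Proof.
apply: clos_rt_symmetric => {x y} x y [] /same_block_sym; first by left.
by right.
Qed.

Let linked_mul_rel a b u v : linked a b u v -> mul_rel a b u v.
Proof.
have refl d := @same_block_refl X d; have trans d := @same_block_trans X d.
have sym d := @same_block_sym X d.
have main1 z z' (x y : X) : same_block a (inl z) (inr x) -> E a b x y ->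
    same_block b (inr z') (inl y) -> mul_rel a b (inl z) (inr z').
  move=> zx xy z'y; have [n [f [f1 fn fB fA]]] := @alternating X (mida a) (midb b)
    x y (fun z => refl a _) (fun z => refl b _) xy.
  exists n.+1, f; split=> //.
  - by rewrite f1.
  - have -> : 2 * n.+1 - 1 = 2 * n + 1 by lia.
    by rewrite fn; exact: sym.
case: u v => [u|u] [v|v] [] //= h.
- by left.
- have [x [y [ux xy vy]]] := h.
  have [n [f [f1 fn fB fA]]] := @alternating X (mida a) (midb b)
    x y (fun z => refl a _) (fun z => refl b _) xy.
  have [n0|n_gt0] := posnP n.
    rewrite n0 in fn; rewrite -f1 in ux; rewrite -fn in vy.
    by left; exact: trans ux (sym _ _ _ vy).
  right; exists n, f; split=> //.
  - by rewrite f1.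
  - by move=> i i_n; apply: fA; lia.
  - apply: trans (fA n _) _; first by lia.
    by rewrite fn; exact: sym.
- by have [x [y [ux xy vy]]] := h; exact: main1 ux xy vy.
- by have [x [y [ux /E_sym xy vy]]] := h; exact: main1 vy xy ux.
- by left.
- have [x [y [ux xy vy]]] := h.
  have {}xy : clos_refl_trans X
      (union X (midb b) (mida a)) x y.
    elim: xy {ux vy h} => [? ? [?|?]|?|? ? ? _ h1 _ h2].
    - by apply: rt_step; right.
    - by apply: rt_step; left.
    - exact: rt_refl.
    - exact: rt_trans h1 h2.
  have [n [f [f1 fn fB fA]]] := @alternating X (midb b) (mida a)
    x y (fun z => refl b _) (fun z => refl a _) xy.
  have [n0|n_gt0] := posnP n.
    rewrite n0 in fn; rewrite -f1 in ux; rewrite -fn in vy.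
    by left; exact: trans ux (sym _ _ _ vy).
  right; exists n, f; split=> //.
  - by rewrite f1.
  - by move=> i i_n; apply: fA; lia.
  - apply: trans (fA n _) _; first by lia.
    by rewrite fn; exact: sym.
Qed.

Section Distinct.
Variables (a b : CS X) (i j k : nat).
Hypotheses (ij : i != j) (jk : j != k) (ik : i != k).

Let glue_a u v : same_block a u v -> glue a b i j k (level i j u) (level i j v).
Proof. by move=> uv; apply: rt_step; left; exists u, v. Qed.

Let glue_b u v : same_block b u v -> glue a b i j k (level j k u) (level j k v).
Proof. by move=> uv; apply: rt_step; right; exists u, v. Qed.

Let mul_rel_glue u v :
  mul_rel a b u v -> glue a b i j k (level i k u) (level i k v).
Proof.
have main1 x y : mul_rel a b (inl x) (inr y) -> glue a b i j k (i, x) (k, y).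
  move=> [s [c [s_gt0 xc cb ca cy]]].
  have h n : n < s -> glue a b i j k (i, x) (j, c (2 * n + 1)).
    elim: n => [_|n IHn n_s]; first exact: glue_a xc.
    apply: rt_trans (IHn _) _; first by lia.
    apply: (@rt_trans _ _ _ (j, c (2 * n.+1))).
      have -> : 2 * n + 1 = 2 * n.+1 - 1 by lia.
      by apply: (glue_b (cb _ _)); lia.
    by apply: (glue_a (ca _ _)); lia.
  have /h hs : s.-1 < s by lia.
  apply: rt_trans hs _; have -> : 2 * s.-1 + 1 = 2 * s - 1 by lia.
  exact: glue_b cy.
case: u v => [x|x] [y|y].
- case=> [/glue_a //|[s [c [s_gt0 xc cb ca cy]]]].
  have h n : n < s -> glue a b i j k (i, x) (j, c (2 * n + 2)).
    elim: n => [_|n IHn n_s].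
      by apply: rt_trans (glue_a xc) _; apply: (glue_b (cb 1 _)); lia.
    apply: rt_trans (IHn _) _; first by lia.
    apply: (@rt_trans _ _ _ (j, c (2 * n.+1 + 1))).
      have -> : 2 * n + 2 = 2 * n.+1 by lia.
      by apply: (glue_a (ca _ _)); lia.
    have -> : 2 * n.+1 + 1 = 2 * n.+2 - 1 by lia.
    have -> : 2 * n.+1 + 2 = 2 * n.+2 by lia.
    by apply: (glue_b (cb _ _)); lia.
  have /h hs : s.-1 < s by lia.
  apply: rt_trans hs _; have -> : 2 * s.-1 + 2 = 2 * s by lia.
  exact: glue_a cy.
- exact: main1.
- by move=> h; apply: glue_sym; apply: main1.
- case=> [/glue_b //|[s [c [s_gt0 xc ca cb cy]]]].
  have h n : n < s -> glue a b i j k (k, x) (j, c (2 * n + 2)).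
    elim: n => [_|n IHn n_s].
      by apply: rt_trans (glue_b xc) _; apply: (glue_a (ca 1 _)); lia.
    apply: rt_trans (IHn _) _; first by lia.
    apply: (@rt_trans _ _ _ (j, c (2 * n.+1 + 1))).
      have -> : 2 * n + 2 = 2 * n.+1 by lia.
      by apply: (glue_b (cb _ _)); lia.
    have -> : 2 * n.+1 + 1 = 2 * n.+2 - 1 by lia.
    have -> : 2 * n.+1 + 2 = 2 * n.+2 by lia.
    by apply: (glue_a (ca _ _)); lia.
  have /h hs : s.-1 < s by lia.
  apply: rt_trans hs _; have -> : 2 * s.-1 + 2 = 2 * s by lia.
  exact: glue_b cy.
Qed.

Let inv u p : Prop :=
  [/\ forall y, p = (i, y) -> linked a b u (inl y),
      forall y, p = (k, y) -> linked a b u (inr y) &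
      forall y, p = (j, y) -> exists2 x, attach a b u x & E a b x y].

Let inv_i u y : linked a b u (inl y) -> inv u (i, y).
Proof.
move=> h; split=> z []; first by move=> <-.
  by move/eqP; rewrite (negPf ik).
by move/eqP; rewrite (negPf ij).
Qed.

Let inv_k u y : linked a b u (inr y) -> inv u (k, y).
Proof.
move=> h; split=> z [].
- by move/eqP; rewrite eq_sym (negPf ik).
- by move=> <-.
- by move/eqP; rewrite eq_sym (negPf jk).
Qed.

Let inv_j u x y : attach a b u x -> E a b x y -> inv u (j, y).
Proof.
move=> ux xy; split=> z [].
- by move/eqP; rewrite eq_sym (negPf ij).
- by move/eqP; rewrite (negPf jk).
- by move=> <-; exists x.
Qed.

Let inv_start u : inv u (level i k u).
Proof.
have refl d := @same_block_refl X d.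
by case: u => x; [apply: inv_i|apply: inv_k]; left; apply: refl.
Qed.

Let inv_step u p q :
  union (nat * X) (edge a i j) (edge b j k) p q -> inv u p -> inv u q.
Proof.
have refl d := @same_block_refl X d; have trans d := @same_block_trans X d.
have sym d := @same_block_sym X d.
case=> -[v [w [-> -> vw]]] [hi hk hj].
- case: v w vw {p q} hi hk hj => [y|y] [z|z] yz /= hi hk hj.
  + apply: inv_i; have [] := hi y erefl.
      by case: u {hi hk hj} => // x xy; left; exact: trans xy yz.
    move=> [c [d [uc cd yd]]]; right; exists c, d; split=> //.
    exact: trans (sym _ _ _ yz) yd.
  + have [] := hi y erefl.
      case: u {hi hk hj} => // x xy; apply: (@inv_j _ z); last exact: rt_refl.
      exact: trans xy yz.
    move=> [c [d [uc cd yd]]]; apply: (inv_j uc); apply: rt_trans cd _.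
    by apply: rt_step; left; exact: trans (sym _ _ _ yd) yz.
  + have [c uc cy] := hj y erefl; apply: inv_i; right.
    by exists c, y; split=> //; exact: sym.
  + have [c uc cy] := hj y erefl; apply: (inv_j uc); apply: rt_trans cy _.
    by apply: rt_step; left.
- case: v w vw {p q} hi hk hj => [y|y] [z|z] yz /= hi hk hj.
  + have [c uc cy] := hj y erefl; apply: (inv_j uc); apply: rt_trans cy _.
    by apply: rt_step; right.
  + have [c uc cy] := hj y erefl; apply: inv_k; right.
    by exists c, y; split=> //; exact: sym.
  + have [] := hk y erefl.
      case: u {hi hk hj} => // x xy; apply: (@inv_j _ z); last exact: rt_refl.
      exact: trans xy yz.
    move=> [c [d [uc cd yd]]]; apply: (inv_j uc); apply: rt_trans cd _.
    by apply: rt_step; right; exact: trans (sym _ _ _ yd) yz.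
  + apply: inv_k; have [] := hk y erefl.
      by case: u {hi hk hj} => // x xy; left; exact: trans xy yz.
    move=> [c [d [uc cd yd]]]; right; exists c, d; split=> //.
    exact: trans (sym _ _ _ yz) yd.
Qed.

Lemma mul_relE u v :
  mul_rel a b u v <-> glue a b i j k (level i k u) (level i k v).
Proof.
split; first exact: mul_rel_glue.
move=> h; apply: linked_mul_rel.
have : inv u (level i k v).
  by elim/clos_refl_trans_ind_left: (level i k v) / h
    => [|p q _ up pq]; [exact: inv_start | exact: inv_step pq up].
by case: v {h} => y [hi hk _]; [exact: hi | exact: hk].
Qed.

End Distinct.

Lemma mul_rel_equivalence a b : equivalence (X + X) (mul_rel a b).
Proof.
have e := @mul_relE a b 0 1 2 erefl erefl erefl.
split=> [u|u v w|u v]; rewrite !e.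
- exact: rt_refl.
- exact: rt_trans.
- exact: glue_sym.
Qed.

Definition CS_mul a b : CS X := CS_of_equivalence (mul_rel_equivalence a b).

Lemma same_block_mul a b u v :
  same_block (CS_mul a b) u v <-> mul_rel a b u v.
Proof. exact: same_block_of_equivalence. Qed.

Lemma clos_rt_contract (T : Type) (K : set T) (R R' S : relation T) x y :
  (forall x y, R x y -> R y x) ->
  (forall x y, S x y -> K x /\ K y) ->
  (forall x y, K x -> K y -> clos_refl_trans T R x y ->
     clos_refl_trans T R' x y) ->
  (forall x y, R' x y -> clos_refl_trans T R x y) ->
  K x -> K y ->
  clos_refl_trans T (union T R S) x y <-> clos_refl_trans T (union T R' S) x y.
Proof.
move=> symR SK RR' R'R Kx Ky.
have mono (P Q : relation T) z t : (forall z t, P z t -> clos_refl_trans T Q z t) ->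
    clos_refl_trans T P z t -> clos_refl_trans T Q z t.
  move=> PQ; elim=> [{}z {}t|{}z|{}z {}t w _ h1 _ h2]; first exact: PQ.
    exact: rt_refl.
  exact: rt_trans h1 h2.
split; last first.
  apply: (mono) => {Kx Ky x y} x y [/R'R|xy]; last by apply: rt_step; right.
  by apply: (mono) => z t zt; apply: rt_step; left.
move=> xy.
have : exists z, [/\ K z, clos_refl_trans T (union T R' S) x z &
    clos_refl_trans T R z y].
  elim/clos_refl_trans_ind_left: y / xy {Ky} => [|y t _ [z [Kz xz zy]] [yt|yt]].
  - by exists x; split=> //; exact: rt_refl.
  - by exists z; split=> //; apply: rt_trans zy _; exact: rt_step.
  - have [Ky Kt] := SK _ _ yt; exists t; split=> //; last exact: rt_refl.
    apply: rt_trans xz _; apply: (@rt_trans _ _ _ y); last first.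
      by apply: rt_step; right.
    by apply: (mono) (RR' _ _ Kz Ky zy) => ? ? ?; apply: rt_step; left.
move=> [z [Kz xz /(RR' _ _ Kz Ky) zy]]; apply: rt_trans xz _.
by apply: (mono) zy => ? ? ?; apply: rt_step; left.
Qed.

Lemma glue_level a b i j k p q : glue a b i j k p q -> p = q \/
  [/\ p.1 \in [:: i; j; k] & q.1 \in [:: i; j; k]].
Proof.
have lev u m n : m \in [:: i; j; k] -> n \in [:: i; j; k] ->
  (level m n u).1 \in [:: i; j; k] by case: u.
have [hi hj hk] : [/\ i \in [:: i; j; k], j \in [:: i; j; k] &
  k \in [:: i; j; k]] by rewrite !inE !eqxx !orbT.
elim=> [{}p {}q|{}p|{}p {}q r _ h1 _ h2].
- by case=> -[u [v [-> -> _]]]; right; split; apply: lev.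
- by left.
- case: h1 h2 => [->|[hp hq]] // [<-|[hq' hr]]; right; split=> //.
Qed.

Lemma edge_mul a b i j k p q : i != j -> j != k -> i != k ->
  p.1 != j -> q.1 != j ->
  glue a b i j k p q -> clos_refl_trans _ (edge (CS_mul a b) i k) p q.
Proof.
move=> ij jk ik pj qj pq; have [->|[]] := glue_level pq; first exact: rt_refl.
have lev r : r.1 != j -> r.1 \in [:: i; j; k] -> exists u, r = level i k u.
  case: r => n x /= nj; rewrite !inE (negPf nj) /= => /orP[] /eqP->.
    by exists (inl x).
  by exists (inr x).
move=> /(lev _ pj) [u pu] /(lev _ qj) [v qv]; apply: rt_step; exists u, v.
by split=> //; apply/same_block_mul/(mul_relE _ _ ij jk ik); rewrite -pu -qv.
Qed.

Lemma mul_edge a b i j k p q : i != j -> j != k -> i != k ->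
  edge (CS_mul a b) i k p q -> glue a b i j k p q.
Proof.
by move=> ij jk ik [u [v [-> -> /same_block_mul/(mul_relE _ _ ij jk ik)]]].
Qed.

Lemma glue_mull a b c u v : glue (CS_mul a b) c 0 2 3 (level 0 3 u) (level 0 3 v) <->
  clos_refl_trans _ (union _ (union _ (edge a 0 1) (edge b 1 2)) (edge c 2 3))
    (level 0 3 u) (level 0 3 v).
Proof.
apply: iff_sym; apply: (@clos_rt_contract _ [set p | p.1 != 1]).
- by move=> p q [] /edge_sym; [left | right].
- by move=> _ _ [[x|x] [[y|y] [-> -> _]]].
- by move=> p q /= pj qj; exact: edge_mul.
- by move=> p q; exact: mul_edge.
- by case: u.
- by case: v.
Qed.

Lemma glue_mulr a b c u v : glue a (CS_mul b c) 0 1 3 (level 0 3 u) (level 0 3 v) <->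
  clos_refl_trans _ (union _ (union _ (edge b 1 2) (edge c 2 3)) (edge a 0 1))
    (level 0 3 u) (level 0 3 v).
Proof.
have -> : glue a (CS_mul b c) 0 1 3 = clos_refl_trans _
    (union _ (edge (CS_mul b c) 1 3) (edge a 0 1)).
  rewrite /glue; congr clos_refl_trans; apply/funext => p; apply/funext => q.
  by apply/propext; rewrite /union or_comm.
apply: iff_sym; apply: (@clos_rt_contract _ [set p | p.1 != 2]).
- by move=> p q [] /edge_sym; [left | right].
- by move=> _ _ [[x|x] [[y|y] [-> -> _]]].
- by move=> p q /= pj qj; exact: edge_mul.
- by move=> p q; exact: mul_edge.
- by case: u.
- by case: v.
Qed.

Lemma CS_mulA : associative CS_mul.
Proof.
move=> a b c; apply: CS_ext => u v; rewrite !same_block_mul.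
rewrite (@mul_relE _ _ 0 1 3) // (@mul_relE _ _ 0 2 3) // glue_mull glue_mulr.
suff -> : union _ (union _ (edge b 1 2) (edge c 2 3)) (edge a 0 1) =
    union _ (union _ (edge a 0 1) (edge b 1 2)) (edge c 2 3) by [].
apply/funext => p; apply/funext => q; apply/propext; rewrite /union; tauto.
Qed.

End Glue.

HB.instance Definition _ (X : Type) := gen_eqMixin (CS X).
HB.instance Definition _ (X : Type) := gen_choiceMixin (CS X).
HB.instance Definition _ (X : Type) := isSemigroup.Build (CS X) (@CS_mulA X).

Definition IP_pred (X : Type) : pred (CS X) := fun a =>
  `[< forall B, blocks a B ->
        (exists x, B (inl x)) /\ (exists x, B (inr x)) >].

Record IP (X : Type) := MkIP { IP_val : CS X; IP_valP : IP_pred IP_val }.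

HB.instance Definition _ (X : Type) := [isSub for @IP_val X].
HB.instance Definition _ (X : Type) := [Choice of IP X by <:].

Lemma IP_predP (X : Type) (a : CS X) : a \in @IP_pred X <->
  (forall x, exists y, same_block a (inl x) (inr y)) /\
  (forall y, exists x, same_block a (inl x) (inr y)).
Proof.
split=> [/asboolP h|[h1 h2]].
  split=> x.
    have [B aB [Bx _]] := same_block_refl a (inl x).
    by have [_ [y By]] := h B aB; exists y, B.
  have [B aB [Bx _]] := same_block_refl a (inr x).
  by have [[y By] _] := h B aB; exists y, B.
apply/asboolP => B aB; have [_ _ /(_ B aB) [[x|x] Bx]] := blocksP a.
  by split; [exists x | have [y xy] := h1 x; exists y; rewrite (blockE aB Bx)].
split; last by exists x.
have [y xy] := h2 x; exists y; rewrite (blockE aB Bx).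
exact: same_block_sym.
Qed.

Lemma IP_mul_closed (X : Type) : mulg_closed (@IP_pred X).
Proof.
move=> a b /IP_predP [a1 a2] /IP_predP [b1 b2]; apply/IP_predP.
have ab x y z : same_block a (inl x) (inr y) -> same_block b (inl y) (inr z) ->
    same_block (a * b)%g (inl x) (inr z).
  move=> xy yz; apply/same_block_mul; exists 1, (fun=> y).
  by split=> // i; lia.
split=> x.
  by have [y xy] := a1 x; have [z yz] := b1 y; exists z; exact: ab xy yz.
by have [y yx] := b2 x; have [z zy] := a2 y; exists z; exact: ab zy yx.
Qed.

HB.instance Definition _ (X : Type) :=
  SubChoice_isSubSemigroup.Build (CS X) (@IP_pred X) (IP X) (@IP_mul_closed X).

Section Relations.
Variable X : Type.
Implicit Types (R S T : set (X * X)).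

(* Relations are composed from left to right, whereas the notation [S \; R]
   stands for R followed by S. *)
Definition rcomp R S : set (X * X) := (S \; R)%relation.

Definition rinv R : set (X * X) := (R^-1)%relation.

Definition equivalences : set (set (X * X)) :=
  [set R | equivalence X (fun x y => R (x, y))].

Definition eqv_join R S : set (X * X) := smallest equivalences (R `|` S).

Definition biequivalence R : Prop :=
  [/\ fst @` R = [set: X], snd @` R = [set: X]
    & rcomp (rcomp R (rinv R)) R = R].

Lemma rcompP R S x z : rcomp R S (x, z) <-> exists2 y, R (x, y) & S (y, z).
Proof. by []. Qed.

Lemma eqv_join_subl R S : R `<=` eqv_join R S.
Proof. by move=> p Rp T [_ RST]; apply: RST; left. Qed.

Lemma eqv_join_subr R S : S `<=` eqv_join R S.
Proof. by move=> p Sp T [_ RST]; apply: RST; right. Qed.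

Lemma eqv_join_equivalence R S : equivalences (eqv_join R S).
Proof.
split=> [x T [[r _ _] _]|x y z xy yz T eT|x y xy T eT]; first exact: r.
  have [[_ t _] _] := eT; exact: t (xy T eT) (yz T eT).
by have [[_ _ s] _] := eT; exact: s (xy T eT).
Qed.

Lemma eqv_join_invariant R S (P : X -> Prop) x y :
  (forall x y, R (x, y) -> P x <-> P y) ->
  (forall x y, S (x, y) -> P x <-> P y) ->
  eqv_join R S (x, y) -> P x <-> P y.
Proof.
move=> PR PS /(_ [set p | P p.1 <-> P p.2]); apply; split; last first.
  by move=> [{}x {}y] [/PR|/PS].
split=> [z|z t w /= h1 h2|z t /= h] //=; first exact: iff_trans h1 h2.
exact: iff_sym.
Qed.

Lemma eqv_join_id R S : equivalences R -> S `<=` R -> eqv_join R S = R.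
Proof.
move=> eR SR; apply/seteqP; split; last exact: eqv_join_subl.
by move=> p; apply; split=> // q [|/SR].
Qed.

Lemma eqv_joinC R S : eqv_join R S = eqv_join S R.
Proof. by rewrite /eqv_join setUC. Qed.

Lemma biequivalence_dom R x : biequivalence R -> exists y, R (x, y).
Proof.
case=> dR _ _; have : [set: X] x by [].
by rewrite -dR => -[[z y] /= zy <-]; exists y.
Qed.

Lemma biequivalence_ran R y : biequivalence R -> exists x, R (x, y).
Proof.
case=> _ rR _; have : [set: X] y by [].
by rewrite -rR => -[[x z] /= xz <-]; exists x.
Qed.

Lemma biequivalence_zigzag R x y z t : biequivalence R ->
  R (x, y) -> R (z, y) -> R (z, t) -> R (x, t).
Proof. by case=> _ _ zR xy zy zt; rewrite -zR; exists z => //; exists y. Qed.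

Lemma biequivalence_intro R : (forall x, exists y, R (x, y)) ->
  (forall y, exists x, R (x, y)) ->
  (forall x y z t, R (x, y) -> R (z, y) -> R (z, t) -> R (x, t)) ->
  biequivalence R.
Proof.
move=> dR rR zR; split.
- by apply/seteqP; split=> // x _; have [y] := dR x; exists (x, y).
- by apply/seteqP; split=> // y _; have [x] := rR y; exists (x, y).
- apply/seteqP; split=> [[x t] [z [y xy zy] zt]|[x y] xy]; first exact: zR xy zy zt.
  by exists x => //; exists y.
Qed.

Lemma biequivalence_coker R : biequivalence R -> equivalences (rcomp (rinv R) R).
Proof.
move=> bR; split=> [y|x y z [u ux uy] [v vy vz]|x y [u ux uy]].
- by have [x xy] := biequivalence_ran y bR; exists x.
- by exists u => //=; exact: biequivalence_zigzag bR uy vy vz.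
- by exists u.
Qed.

Lemma biequivalence_ker R : biequivalence R -> equivalences (rcomp R (rinv R)).
Proof.
move=> bR; split=> [x|x y z [u xu yu] [v yv zv]|x y [u xu yu]].
- by have [y xy] := biequivalence_dom x bR; exists y.
- by exists v => //=; exact: biequivalence_zigzag bR xu yu yv.
- by exists u.
Qed.

Definition bieq_mul R S : set (X * X) :=
  rcomp (rcomp R (eqv_join (rcomp (rinv R) R) (rcomp S (rinv S)))) S.

Lemma bieq_mulP R S x t : bieq_mul R S (x, t) <-> exists y z,
  [/\ R (x, y), eqv_join (rcomp (rinv R) R) (rcomp S (rinv S)) (y, z)
    & S (z, t)].
Proof.
split=> [[z [y xy yz] zt]|[y [z [xy yz zt]]]]; first by exists y, z.
by exists z => //; exists y.
Qed.

Lemma biequivalence_mul R S :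
  biequivalence R -> biequivalence S -> biequivalence (bieq_mul R S).
Proof.
move=> bR bS; set J := eqv_join (rcomp (rinv R) R) (rcomp S (rinv S)).
have [r t s] : equivalences J by exact: eqv_join_equivalence.
apply: biequivalence_intro => [x|z|x y z w].
- have [y xy] := biequivalence_dom x bR; have [z yz] := biequivalence_dom y bS.
  by exists z; apply/bieq_mulP; exists y, y; split=> //; exact: r.
- have [y yz] := biequivalence_ran z bS; have [x xy] := biequivalence_ran y bR.
  by exists x; apply/bieq_mulP; exists y, y; split=> //; exact: r.
- move=> /bieq_mulP [a [b [xa ab b_y]]] /bieq_mulP [c [d [zc cd dy]]].
  move=> /bieq_mulP [e [f [ze ef fw]]]; apply/bieq_mulP; exists a, f; split=> //.
  have bd : J (b, d) by apply: eqv_join_subr; exists y.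
  have ce : J (c, e) by apply: eqv_join_subl; exists z.
  exact: t ab (t _ _ _ bd (t _ _ _ (s _ _ cd) (t _ _ _ ce ef))).
Qed.

Lemma diagonal_biequivalence : biequivalence diagonal.
Proof.
apply: biequivalence_intro => [x|x|x y z t]; [by exists x | by exists x |].
by rewrite /diagonal /= => -> <-.
Qed.

Lemma bieq_mul1 R : biequivalence R -> bieq_mul R diagonal = R.
Proof.
move=> bR; rewrite /bieq_mul eqv_join_id; last 2 first.
- exact: biequivalence_coker.
- move=> [x y] [z]; rewrite /rinv /diagonal /= => -> ->.
  by have [r _ _] := biequivalence_coker bR; exact: r.
apply/seteqP; split=> [[x t] [z [y xy [w wy wz]]]|[x y] xy].
  by rewrite /diagonal /= => <-; exact: biequivalence_zigzag bR xy wy wz.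
by exists y => //; exists y => //; exists x.
Qed.

Lemma bieq_1mul R : biequivalence R -> bieq_mul diagonal R = R.
Proof.
move=> bR; rewrite /bieq_mul eqv_joinC eqv_join_id; last 2 first.
- exact: biequivalence_ker.
- move=> [x y] [z]; rewrite /rinv /diagonal /= => <- <-.
  by have [r _ _] := biequivalence_ker bR; exact: r.
apply/seteqP; split=> [[x t] [z [y xy [w yw zw]] zt]|[x y] xy].
  by rewrite /diagonal /= in xy; rewrite xy; exact: biequivalence_zigzag bR yw zw zt.
by exists x => //; exists x => //; exists y.
Qed.

Lemma bieq_mulA R S T : biequivalence R -> biequivalence S -> biequivalence T ->
  bieq_mul R (bieq_mul S T) = bieq_mul (bieq_mul R S) T.
Proof.
move=> bR bS bT.
pose J1 := eqv_join (rcomp (rinv R) R) (rcomp S (rinv S)).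
pose J2 := eqv_join (rcomp (rinv S) S) (rcomp T (rinv T)).
pose ST := bieq_mul S T; pose RS := bieq_mul R S.
pose K1 := eqv_join (rcomp (rinv R) R) (rcomp ST (rinv ST)).
pose K2 := eqv_join (rcomp (rinv RS) RS) (rcomp T (rinv T)).
have [r1 t1 s1] : equivalences J1 by exact: eqv_join_equivalence.
have [r2 t2 s2] : equivalences J2 by exact: eqv_join_equivalence.
have [q1 u1 v1] : equivalences K1 by exact: eqv_join_equivalence.
have [q2 u2 v2] : equivalences K2 by exact: eqv_join_equivalence.
have JT1 x y : J1 (x, y) -> K1 (x, y).
  apply; split; first exact: eqv_join_equivalence.
  move=> [{}x {}y] [xy|[z xz yz]]; first exact: eqv_join_subl.
  have [t zt] := biequivalence_dom z bT.
  apply: eqv_join_subr; exists t; apply/bieq_mulP; exists z, z; split=> //;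
    exact: r2.
have JT2 x y : J2 (x, y) -> K2 (x, y).
  apply; split; first exact: eqv_join_equivalence.
  move=> [{}x {}y] [[z zx zy]|xy]; last exact: eqv_join_subr.
  have [t tz] := biequivalence_ran z bR.
  apply: eqv_join_subl; exists t; apply/bieq_mulP; exists z, z; split=> //;
    exact: r1.
pose left x y := exists z t, [/\ K1 (x, z), S (z, t) & J2 (t, y)].
pose right x y := exists z t, [/\ J1 (x, z), S (z, t) & K2 (t, y)].
have left_right x y : left x y -> right x y.
  move=> [z [t [xz zt ty]]].
  suff : right z y.
    suff -> : right z y <-> right x y by [].
    apply: (@eqv_join_invariant _ _ (right^~ y) _ _ _ _ (v1 _ _ xz)).
      move=> a b [c ca cb]; have ab : J1 (a, b) by apply: eqv_join_subl; exists c.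
      split=> -[d [e [ad de ey]]]; exists d, e; split=> //.
        exact: t1 (s1 _ _ ab) ad.
      exact: t1 ab ad.
    have half a b c : ST (a, c) -> ST (b, c) -> right a y -> right b y.
      move=> /bieq_mulP [d [e [ad de ec]]] /bieq_mulP [f [g [bf fg gc]]].
      move=> [h [i [ah hi iy]]]; exists b, f; split=> //.
      have fe : J2 (f, e).
        by apply: (t2 _ _ _ fg); apply: eqv_join_subr; exists c.
      have fd : J2 (f, d) by exact: t2 fe (s2 _ _ de).
      apply: (u2 _ _ _ (JT2 _ _ fd)); apply: (u2 _ _ _ _ iy).
      have [k ka] := biequivalence_ran a bR.
      apply: eqv_join_subl; exists k; apply/bieq_mulP.
        by exists a, a; split=> //; exact: r1.
      by exists a, h.
    move=> a b [c ac bc]; split; first exact: half ac bc.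
    exact: half bc ac.
  by exists z, t; split=> //; exact: JT2.
have right_left x y : right x y -> left x y.
  move=> [z [t [xz zt ty]]].
  suff : left x t.
    suff -> : left x t <-> left x y by [].
    apply: (@eqv_join_invariant _ _ (left x) _ _ _ _ ty); last first.
      move=> a b [c ac bc]; have ab : J2 (a, b) by apply: eqv_join_subr; exists c.
      split=> -[d [e [xd de ey]]]; exists d, e; split=> //.
        exact: t2 ey ab.
      exact: t2 ey (s2 _ _ ab).
    have half a b c : RS (c, a) -> RS (c, b) -> left x a -> left x b.
      move=> /bieq_mulP [d [e [cd de ea]]] /bieq_mulP [f [g [cf fg gb]]].
      move=> [h [i [xh hi ia]]]; exists g, b; split=> //.
      have df : J1 (d, f) by apply: eqv_join_subl; exists c.
      have eg : J1 (e, g) by exact: t1 (s1 _ _ de) (t1 _ _ _ df fg).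
      apply: (u1 _ _ _ _ (JT1 _ _ eg)); apply: (u1 _ _ _ xh).
      have [k ak] := biequivalence_dom a bT.
      apply: eqv_join_subr; exists k; apply/bieq_mulP.
        by exists i, a.
      by exists a, a; split=> //; exact: r2.
    move=> a b [c ca cb]; split; first exact: half ca cb.
    exact: half cb ca.
  by exists z, t; split=> //; exact: JT1.
apply/seteqP; split=> -[x t] /bieq_mulP.
  move=> [y [z [xy yz /bieq_mulP [a [b [za ab bt]]]]]].
  have /left_right [c [d [yc cd db]]] : left y b by exists z, a.
  by apply/bieq_mulP; exists d, b; split=> //; apply/bieq_mulP; exists y, c.
move=> [y [z [/bieq_mulP [a [b [xa ab b_y]]] yz zt]]].
have /right_left [c [d [ac cd dz]]] : right a z by exists b, y.
by apply/bieq_mulP; exists a, c; split=> //; apply/bieq_mulP; exists d, z.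
Qed.

End Relations.

Record Istar (X : Type) := MkIstar {
  Istar_rel : set (X * X);
  IstarP : biequivalence Istar_rel }.

Section IstarMonoid.
Variable X : Type.
Implicit Types a b c : Istar X.

Lemma Istar_rel_inj : injective (@Istar_rel X).
Proof.
move=> [R bR] [S bS] /= RS; rewrite RS in bR *.
by congr MkIstar; exact: Prop_irrelevance.
Qed.

Definition Istar_mul a b : Istar X :=
  MkIstar (biequivalence_mul (IstarP a) (IstarP b)).

Definition Istar_one : Istar X := MkIstar (@diagonal_biequivalence X).

Lemma Istar_mulA : associative Istar_mul.
Proof.
move=> a b c; apply: Istar_rel_inj.
exact: bieq_mulA (IstarP a) (IstarP b) (IstarP c).
Qed.

Lemma Istar_mul1 : right_id Istar_one Istar_mul.
Proof. by move=> a; apply: Istar_rel_inj; exact: bieq_mul1 (IstarP a). Qed.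

Lemma Istar_1mul : left_id Istar_one Istar_mul.
Proof. by move=> a; apply: Istar_rel_inj; exact: bieq_1mul (IstarP a). Qed.

End IstarMonoid.

HB.instance Definition _ (X : Type) := gen_eqMixin (Istar X).
HB.instance Definition _ (X : Type) := gen_choiceMixin (Istar X).
HB.instance Definition _ (X : Type) :=
  isMonoid.Build (Istar X) (@Istar_mulA X) (@Istar_1mul X) (@Istar_mul1 X).

(* Main.v *)
Require Import Defs.
From Stdlib Require Import Relations.
From HB Require Import structures.
From mathcomp Require Import all_boot zify.
From mathcomp Require Import boolp classical_sets.

(** In a partition all of whose blocks meet both X and X', the relation "x and
    y' lie in the same block" is a biequivalence whose kernel and cokernel are
    the restrictions of the partition to X and X'; so it determines the
    partition. An alternating path witnessing x == y' in a product is then a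
    walk in the join of the cokernel of the first factor and the kernel of the
    second. *)

Set Implicit Arguments.
Unset Strict Implicit.
Unset Printing Implicit Defensive.

Local Open Scope classical_set_scope.

Section Transversal.
Variable X : Type.
Implicit Types (a b : IP X) (R : Istar X) (x y z : X).

Definition transversal_rel a : set (X * X) :=
  [set p | same_block (val a) (inl p.1) (inr p.2)].

Lemma transversal_relP a x y :
  transversal_rel a (x, y) <-> same_block (val a) (inl x) (inr y).
Proof. by []. Qed.

Lemma IP_dom a x : exists y, same_block (val a) (inl x) (inr y).
Proof. by have /IP_predP[+ _] := valP a; apply. Qed.

Lemma IP_ran a y : exists x, same_block (val a) (inl x) (inr y).
Proof. by have /IP_predP[_ +] := valP a; apply. Qed.

Lemma transversal_biequivalence a : biequivalence (transversal_rel a).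
Proof.
apply: biequivalence_intro => [x|y|x y z t xy zy zt].
- exact: IP_dom.
- exact: IP_ran.
- exact: same_block_trans (same_block_trans xy (same_block_sym zy)) zt.
Qed.

(** A block containing [inl x] and [inl y] also meets X', and any of its points there serves as the
    middle point of the composite. *)
Lemma transversal_ker a x y :
  rcomp (transversal_rel a) (rinv (transversal_rel a)) (x, y) <->
  same_block (val a) (inl x) (inl y).
Proof.
split=> [[z xz yz]|xy]; first exact: same_block_trans xz (same_block_sym yz).
have [z yz] := IP_dom a y.
by exists z => //; exact: same_block_trans xy yz.
Qed.

Lemma transversal_coker a x y :
  rcomp (rinv (transversal_rel a)) (transversal_rel a) (x, y) <->
  same_block (val a) (inr x) (inr y).
Proof.
split=> [[z zx zy]|xy]; first exact: same_block_trans (same_block_sym zx) zy.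
have [z zx] := IP_ran a x.
by exists z => //; exact: same_block_trans zx xy.
Qed.

Definition transversal a : Istar X := MkIstar (transversal_biequivalence a).

Lemma mul_rel_transversal a b x z :
  mul_rel (val a) (val b) (inl x) (inr z) <->
  bieq_mul (transversal_rel a) (transversal_rel b) (x, z).
Proof.
set J := eqv_join (rcomp (rinv (transversal_rel a)) (transversal_rel a))
                  (rcomp (transversal_rel b) (rinv (transversal_rel b))).
have [Jrefl Jtrans _] : equivalences J by exact: eqv_join_equivalence.
have Ja y t : same_block (val a) (inr y) (inr t) -> J (y, t).
  by move=> /transversal_coker; exact: eqv_join_subl.
have Jb y t : same_block (val b) (inl y) (inl t) -> J (y, t).
  by move=> /transversal_ker; exact: eqv_join_subr.
split=> [[s [c [s_gt0 xc cb ca cz]]]|/bieq_mulP[y [w [xy yw wz]]]].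
  apply/bieq_mulP; exists (c 1), (c (2 * s - 1)); split=> //.
  (* Only odd-indexed points are tracked: each round makes one step in the kernel of the second
     factor, then one in the cokernel of the first. *)
  have walk n : n < s -> J (c 1, c (2 * n + 1)).
    elim: n => [_|n IHn ns]; first exact: Jrefl.
    apply: (Jtrans _ _ _ (IHn (ltnW ns))); apply: (Jtrans _ (c (2 * n.+1))).
      have -> : 2 * n + 1 = 2 * n.+1 - 1 by lia.
      by apply: (Jb _ _ (cb n.+1 _)); lia.
    by apply: (Ja _ _ (ca n.+1 _)); lia.
  have -> : 2 * s - 1 = 2 * s.-1 + 1 by lia.
  by apply: walk; lia.
(* In the glued graph any walk from level 0 to level 2 suffices, with no alternation to maintain. *)
rewrite (@mul_relE _ _ _ 0 1 2) //.
have glued_yw : glue (val a) (val b) 0 1 2 (1, y) (1, w).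
  have step u v : glue (val a) (val b) 0 1 2 (1, u) (1, v) ->
      glue (val a) (val b) 0 1 2 (1, y) (1, u) <->
      glue (val a) (val b) 0 1 2 (1, y) (1, v).
    move=> uv; split=> h; first exact: rt_trans h uv.
    exact: rt_trans h (glue_sym uv).
  (* The join is the smallest equivalence containing both relations, so a property preserved by each
     is constant on its classes; here it is reachability from [(1, y)]. *)
  apply: (iffLR (@eqv_join_invariant _ _ _
    (fun v => glue (val a) (val b) 0 1 2 (1, y) (1, v)) _ _ _ _ yw)).
  - move=> u v /transversal_coker uv; apply: step; apply: rt_step; left.
    by exists (inr u), (inr v).
  - move=> u v /transversal_ker uv; apply: step; apply: rt_step; right.
    by exists (inl u), (inl v).
  - exact: rt_refl.
apply: (@rt_trans _ _ _ (1, y)).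
  by apply: rt_step; left; exists (inl x), (inr y).
apply: rt_trans glued_yw _.
by apply: rt_step; right; exists (inl w), (inr z).
Qed.

Lemma transversalM : {morph transversal : a b / (a * b)%g}.
Proof.
move=> a b; apply: Istar_rel_inj.
have mulE x z : transversal_rel (a * b)%g (x, z) <->
    bieq_mul (transversal_rel a) (transversal_rel b) (x, z).
  by rewrite -mul_rel_transversal; exact: same_block_mul.
by apply/seteqP; split=> -[x z] /mulE.
Qed.

Lemma transversal_inj : injective transversal.
Proof.
move=> a b /(congr1 (@Istar_rel X)) /= ab.
apply: val_inj; apply: CS_ext => -[x|x] [y|y].
- by rewrite -!transversal_ker ab.
- by rewrite -!transversal_relP ab.
- split=> /same_block_sym xy; apply: same_block_sym; move: xy;
  by rewrite -!transversal_relP ab.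
- by rewrite -!transversal_coker ab.
Qed.

(* Every block of the partition defined by [R] is determined by its trace on
   X', which is the [R]-image of x for the block of x, and the class of y under
   the cokernel of [R] for the block of y'. *)
Definition trace R (u : X + X) : set X := match u with
  | inl x => [set z | Istar_rel R (x, z)]
  | inr y => [set z | rcomp (rinv (Istar_rel R)) (Istar_rel R) (y, z)] end.

(** From left to right, y lies in its own cokernel class, hence in the image of x. Conversely, the
    zigzag law makes the image of x the whole cokernel class of y. *)
Lemma trace_lr R x y : trace R (inl x) = trace R (inr y) <-> Istar_rel R (x, y).
Proof.
split=> [e|xy].
  suff : trace R (inl x) y by [].
  by rewrite e; have [refl _ _] := biequivalence_coker (IstarP R); exact: refl.
apply/seteqP; split=> z /=; first by move=> xz; exists x.
by move=> [w wy wz]; exact: biequivalence_zigzag (IstarP R) xy wy wz.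
Qed.

Lemma trace_equivalence R :
  equivalence (X + X) (fun u v => trace R u = trace R v).
Proof. by split=> // u v w ->. Qed.

(** Fullness of the relation gives each block a point on the other side. *)
Lemma trace_IP R : @IP_pred X (CS_of_equivalence (trace_equivalence R)).
Proof.
apply/IP_predP; split=> [x|y].
  have [y xy] := biequivalence_dom x (IstarP R).
  by exists y; apply/same_block_of_equivalence/trace_lr.
have [x xy] := biequivalence_ran y (IstarP R).
by exists x; apply/same_block_of_equivalence/trace_lr.
Qed.

Definition of_biequivalence R : IP X := MkIP (trace_IP R).

Lemma of_biequivalenceK : cancel of_biequivalence transversal.
Proof.
move=> R; apply: Istar_rel_inj; apply/seteqP; split=> -[x y].
  by move=> /same_block_of_equivalence/trace_lr.
by move=> xy; apply/same_block_of_equivalence/trace_lr.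
Qed.

End Transversal.

HB.instance Definition _ (X : Type) :=
  isMultiplicative.Build (IP X) (Istar X) (@transversal X) (@transversalM X).

Theorem theorem1 (X : Type) :
  exists f : {multiplicative IP X -> Istar X}, bijective f.
Proof.
exists (@transversal X); exists (@of_biequivalence X).
  (* A right inverse of an injective map is also a left inverse, so no partition has to be rebuilt
     from its traces. *)
  exact: inj_can_sym (@of_biequivalenceK X) (@transversal_inj X).
exact: of_biequivalenceK.
Qed.
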